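(* There is a universal constant $C$ such that for every Boolean function $f:\{0,1\}^n\to\{0,1\}$, $\deg(f)\le C\,\mathrm{Q}(f)^2$.
   Context: $\deg(f)$ is the degree of the unique multilinear real polynomial agreeing with $f$ on $\{0,1\}^n$. $\mathrm{Q}(f)$ is the bounded-error quantum query complexity of $f$: the minimum number of queries of a quantum query algorithm that outputs $f(x)$ with probability at least $2/3$ on every input $x$. *)

(* Defs.v *)
(* Real scalars: Stdlib's R (a realType via Rstruct);
   complex amplitudes: R[i] from mathcomp-real-closed. *)
From mathcomp Require Import all_boot all_order all_algebra.
From mathcomp Require Import reals Rstruct.
From mathcomp Require Import complex.
Set Implicit Arguments. Unset Strict Implicit. Unset Printing Implicit Defensive.
Import Order.TTheory GRing.Theory Num.Theory.
Local Open Scope ring_scope.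

Notation R := Rdefinitions.R.
Notation C := (R[i]).

(* Inputs x in {0,1}^n, Boolean functions f : {0,1}^n -> {0,1}. *)
Definition input (n : nat) := {ffun 'I_n -> bool}.

(* ---------- Degree ---------- *)
(* A real multilinear polynomial in x_1..x_n is given by its coefficients
   c_S on the monomials prod_{i in S} x_i, S subset of [n]. *)
Definition mlpoly (n : nat) := {ffun {set 'I_n} -> R}.

Definition mleval n (p : mlpoly n) (x : input n) : R :=
  \sum_(S : {set 'I_n}) p S * \prod_(i in S) ((x i)%:R : R).

(* p agrees with f on {0,1}^n *)
Definition agrees n (p : mlpoly n) (f : input n -> bool) : Prop :=
  forall x : input n, mleval p x = (f x)%:R.

(* degree of a multilinear polynomial (0 for the zero polynomial) *)
Definition mldeg n (p : mlpoly n) : nat := \max_(S | p S != 0) #|S|.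

(* ---------- Quantum query algorithms ---------- *)
(* conjugate transpose and unitarity *)
Definition adjmx m (U : 'M[C]_m) : 'M[C]_m := map_mx (fun z => z^*) U^T.
Definition unitary m (U : 'M[C]_m) : Prop := U *m adjmx U = 1%:M.

(* The state space has orthonormal basis indexed by 'I_m.+1; each basis
   state j carries a query index qreg j : option 'I_n (None = no query).
   The (phase) oracle for input x maps |j> to (-1)^(x_i)|j> if qreg j =
   Some i and to |j> if qreg j = None. *)
Definition oracle n m (qreg : 'I_m -> option 'I_n) (x : input n) : 'M[C]_m :=
  diag_mx (\row_j match qreg j with
                  | Some i => (-1) ^+ (x i)
                  | None => 1 end).

(* initial state |0> *)
Definition init m : 'cV[C]_m.+1 := delta_mx 0 0.

(* state after U_t O_x U_{t-1} ... O_x U_0 |0>  (t queries) *)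
Fixpoint run m (U : nat -> 'M[C]_m.+1) (O : 'M[C]_m.+1) (t : nat)
  : 'cV[C]_m.+1 :=
  match t with
  | 0 => U 0%N *m init m
  | t'.+1 => U t *m (O *m run U O t')
  end.

(* squared modulus, as a real number *)
Definition sqmod (z : C) : R := (complex.Re z) ^+ 2 + (complex.Im z) ^+ 2.

(* A T-query algorithm: workspace dimension m.+1, query labelling qreg,
   unitaries U 0, ..., U T, and accepting set of basis states acc
   (final measurement in the computational basis; output 1 iff the
   outcome lies in acc). *)
Record qalg (n : nat) := QAlg {
  qa_dim : nat;
  qa_qreg : 'I_qa_dim.+1 -> option 'I_n;
  qa_U : nat -> 'M[C]_qa_dim.+1;
  qa_acc : {set 'I_qa_dim.+1} }.
Arguments qa_dim {n} q.
Arguments qa_qreg {n} q _.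
Arguments qa_U {n} q _.
Arguments qa_acc {n} q.

(* probability that the T-query algorithm A outputs 1 on input x *)
Definition accept_prob n (A : qalg n) (T : nat) (x : input n) : R :=
  \sum_(j in qa_acc A)
     sqmod (run (qa_U A) (oracle (qa_qreg A) x) T j 0).

(* A is a valid T-query algorithm computing f with bounded error 1/3 *)
Definition computes n (f : input n -> bool) (T : nat) (A : qalg n) : Prop :=
  (forall t, (t <= T)%N -> unitary (qa_U A t)) /\
  (forall x : input n,
     if f x then accept_prob A T x >= 2 / 3
     else 1 - accept_prob A T x >= 2 / 3).

Definition has_Qalg n (f : input n -> bool) (T : nat) : Prop :=
  exists A : qalg n, computes f T A.

(* Q(f) = T : T is the minimum number of queries of a bounded-error
   quantum query algorithm for f. *)
Definition isQ n (f : input n -> bool) (T : nat) : Prop :=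
  has_Qalg f T /\ forall T', has_Qalg f T' -> (T <= T')%N.

(* Main.v *)
(* Let d = deg f and let S index a monomial of top degree.  On the subcube K of
   points supported in S, the function f (+) parity is unbalanced, so one of its
   level sets H in K has more than |K|/2 points, and along a cube edge inside H
   the value of f changes.  Huang's signed adjacency matrix B of K satisfies
   B^2 = d, hence has a vector v supported on H with B v = sqrt d v; its
   absolute value u gives u^T A u >= sqrt d |u|^2 for the adjacency matrix A of
   the sensitive edges of f.  Conversely, the adversary argument with weights
   u_x u_y bounds u^T A u by 36 T |u|^2 for a T-query algorithm: the edges in
   each direction form a matching, so one query changes
   sum_xy A_xy u_x u_y <psi_x, psi_y> by at most 2 |u|^2. *)
Require Import Defs.
From mathcomp Require Import all_boot all_order all_algebra.
From mathcomp Require Import reals Rstruct complex.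
From mathcomp Require Import ring lra.
Import Order.TTheory GRing.Theory Num.Theory.
Local Open Scope ring_scope.

(** * Bit flips and parity on the cube *)

Definition flip n (i : 'I_n) (x : input n) : input n :=
  [ffun j => (j == i) (+) x j].

Lemma flipK n (i : 'I_n) : involutive (flip n i).
Proof. by move=> x; apply/ffunP=> j; rewrite !ffunE addbA addbb. Qed.

Lemma flipC n (i j : 'I_n) x : flip n i (flip n j x) = flip n j (flip n i x).
Proof. by apply/ffunP=> k; rewrite !ffunE addbCA. Qed.

Lemma flip_neq n (i j : 'I_n) x : j != i -> flip n i x j = x j.
Proof. by rewrite ffunE => /negPf ->. Qed.

Lemma flip_sum n (i : 'I_n) (F : input n -> R) :
  \sum_x F (flip n i x) = \sum_x F x.
Proof.
rewrite [RHS](reindex (flip n i)) //; apply: onW_bij.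
exact: inv_bij (flipK n i).
Qed.

Definition parity n (P : pred 'I_n) (x : input n) : bool :=
  \big[addb/false]_(j | P j) x j.

Lemma parity_flip n (P : pred 'I_n) i x :
  parity n P (flip n i x) = P i (+) parity n P x.
Proof.
rewrite /parity (eq_bigr (fun j => (j == i) (+) x j)); last first.
  by move=> j _; rewrite ffunE.
rewrite big_split /=; congr addb.
case Pi: (P i).
  rewrite (bigD1 i) //= eqxx big1 // => j /andP[_ ji]; exact: negPf ji.
by apply: big1 => j Pj; apply/eqP => ji; rewrite ji Pi in Pj.
Qed.

(** The block of [M] with rows in [A] and columns in [B] has rank at most [#|B|], hence a nonzero
    left kernel vector; [v] is its extension by zero. *)
Lemma underdetermined (F : fieldType) (X : finType) (A B : {set X})
    (M : X -> X -> F) :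
  (#|B| < #|A|)%N ->
  exists v : X -> F, [/\ exists x, v x != 0,
    forall x, x \notin A -> v x = 0 &
    forall y, y \in B -> \sum_x M x y * v x = 0].
Proof.
move=> ltBA.
pose N : 'M[F]_(#|A|, #|B|) := \matrix_(i, j) M (enum_val i) (enum_val j).
have /rowV0Pn[w /sub_kermxP wN w0] : kermx N != 0.
  rewrite -mxrank_eq0 mxrank_ker subn_eq0 -ltnNge.
  exact: leq_ltn_trans (rank_leq_col N) ltBA.
exists (fun x => \sum_(k | enum_val k == x) w 0 k); split.
- have [k wk] : exists k, w 0 k != 0.
    apply/existsP; apply: contraNT w0 => /existsPn w0; apply/eqP/rowP => k.
    by rewrite mxE; apply/eqP; have := w0 k; rewrite negbK.
  exists (enum_val k); rewrite (big_pred1 k) // => l /=.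
  by rewrite (inj_eq enum_val_inj).
- move=> x xA; apply: big1 => k /eqP xk.
  by move: xA; rewrite -xk enum_valP.
- move=> y yB; have := congr1 (fun z : 'rV_ _ => z 0 (enum_rank_in yB y)) wN.
  rewrite !mxE; apply: etrans.
  under eq_bigr => x _ do rewrite mulr_sumr.
  rewrite (exchange_big_dep xpredT) //=; apply: eq_bigr => k _.
  rewrite (big_pred1 (enum_val k)) => [|x]; last by rewrite eq_sym.
  by rewrite mxE enum_rankK_in // mulrC.
Qed.

(** * Top-degree coefficients and unbalanced level sets *)

Definition subcube n (S : {set 'I_n}) : pred (input n) :=
  fun x => [forall i, (i \notin S) ==> ~~ x i].

Lemma subcube_flip n (S : {set 'I_n}) i x :
  i \in S -> subcube n S (flip n i x) = subcube n S x.
Proof.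
move=> iS; apply: eq_forallb => j; case: (boolP (j \in S)) => //= jS.
by rewrite flip_neq //; apply: contraNneq jS => ->.
Qed.

(** Flipping [i] permutes the subcube, fixes [G] and reverses the parity sign, so the terms cancel
    in pairs. *)
Lemma signed_sum_flip0 n (S : {set 'I_n}) i (G : input n -> R) :
  i \in S -> (forall x, G (flip n i x) = G x) ->
  \sum_(x | subcube n S x) (-1) ^+ parity n predT x * G x = 0.
Proof.
move=> iS Gi; set s := \sum_(x | _) _.
suff: s = - s by move=> ?; lra.
rewrite /s [LHS]big_mkcond /= -(flip_sum n i) -big_mkcond /= -sumrN.
rewrite big_mkcond [RHS]big_mkcond; apply: eq_bigr => x _.
rewrite /= subcube_flip // parity_flip Gi; case: ifP => // _.
by rewrite signr_addb mulN1r mulNr.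
Qed.

(** By maximality, a monomial [S'] other than [S] with nonzero coefficient misses some [i] in [S],
    so its signed sum cancels under [flip i]. The monomial [S] is nonzero only at the vertex [top],
    whose parity is [b]. *)
Lemma leading_coef_sum n (p : mlpoly n) (S : {set 'I_n}) :
  (forall S', p S' != 0 -> (#|S'| <= #|S|)%N) ->
  exists b : bool,
    \sum_(x | subcube n S x) (-1) ^+ parity n predT x * mleval p x = (-1) ^+ b * p S.
Proof.
move=> Smax.
pose top : input n := [ffun i => i \in S].
exists (parity n predT top).
under eq_bigr => x _ do rewrite /mleval mulr_sumr.
rewrite exchange_big /= (bigD1 S) //= [X in _ + X]big1 ?addr0 =>
  [|S' S'S]; last first.
  under eq_bigr => x _ do rewrite mulrCA.
  rewrite -mulr_sumr; have [->|pS'] := eqVneq (p S') 0; first by rewrite mul0r.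
  have /subsetPn[i iS iS'] : ~~ (S \subset S').
    apply: contra S'S => SS'; rewrite eq_sym eqEcard SS' /=; exact: Smax.
  rewrite (signed_sum_flip0 n S i) ?mulr0 // => x.
  apply: eq_bigr => j jS'; rewrite flip_neq //.
  by apply: contraNneq iS' => <-.
rewrite (bigD1 top) /=; last first.
  by apply/forallP => i; apply/implyP; rewrite ffunE.
rewrite big1 ?mulr1; last by move=> i iS; rewrite ffunE iS.
rewrite big1 ?addr0 // => x /andP[/forallP xS xtop].
have [i iS xi] : exists2 i, i \in S & ~~ x i.
  apply/exists_inP; apply: contraNT xtop => /exists_inPn h.
  apply/eqP/ffunP => i; rewrite ffunE; case: (boolP (i \in S)) => iS.
    by have := h i iS; rewrite negbK.
  by have := xS i; rewrite iS => /negPf.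
by rewrite (bigD1 i) //= (negPf xi) mul0r !mulr0.
Qed.

Lemma card_pred_sumr (X : finType) (P : pred X) :
  #|[set x | P x]|%:R = \sum_x (P x)%:R :> R.
Proof.
rewrite -sum1_card natr_sum big_mkcond; apply: eq_bigr => x _.
by rewrite inE; case: (P x).
Qed.

(** The odd points are half of the subcube, and the nonzero signed sum measures by how much the
    level sets of [f] (+) parity deviate from that half, with opposite signs for the two values of
    [b]. *)
Lemma unbalanced_half n (S : {set 'I_n}) i (f : input n -> bool) :
  i \in S ->
  \sum_(x | subcube n S x) (-1) ^+ parity n predT x * (f x)%:R != 0 :> R ->
  exists b : bool,
    (#|[set x | subcube n S x && parity n predT x]| <
     #|[set x | subcube n S x && (f x (+) parity n predT x == b)]|)%N.
Proof.
move=> iS; set s := \sum_(x | _) _ => s0.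
have balanced : \sum_(x | subcube n S x) (-1) ^+ parity n predT x * 1 = 0 :> R.
  exact: (signed_sum_flip0 n S i (fun=> 1)).
have card_diff b :
  #|[set x | subcube n S x && (f x (+) parity n predT x == b)]|%:R
  - #|[set x | subcube n S x && parity n predT x]|%:R = (-1) ^+ (~~ b) * s :> R.
  (* For [b = false] the difference is the signed sum over the zeros of [f]; subtracting the
     vanishing sum [balanced] turns it into minus the sum over the ones. *)
  rewrite !card_pred_sumr -sumrB -[LHS]subr0 -[X in _ - X](mulr0 (~~ b)%:R).
  rewrite -[X in _ - _ * X]balanced /s.
  rewrite !(big_mkcond (subcube n S)) !mulr_sumr -sumrB.
  apply: eq_bigr => x _; case: (subcube n S x) => /=; last by ring.
  by case: (f x); case: (parity n predT x); case: b => /=; ring.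
exists (0 < s); rewrite -(ltr_nat R) -subr_gt0 card_diff.
by case: (ltgtP 0 s) s0 => //= s_ _; rewrite ?mulN1r ?oppr_gt0 ?mul1r.
Qed.

(** * Huang's signed adjacency matrix of the cube *)

Definition edge_sign n (x : input n) (i : 'I_n) : R :=
  (-1) ^+ parity n (fun j => (j < i)%N) x.

(** The parity that defines the sign in direction [i] omits coordinate [i], so an edge has the same
    sign from both ends. *)
Lemma edge_sign_sqr n x i : edge_sign n x i * edge_sign n (flip n i x) i = 1.
Proof. by rewrite /edge_sign parity_flip ltnn addFb -signr_addb addbb. Qed.

(** Only the flip in the smaller of the two directions changes the sign of the other one, so the two
    paths across a square have opposite signs. *)
Lemma edge_sign_anticomm n x i j : i != j ->
  edge_sign n x i * edge_sign n (flip n i x) j =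
  - (edge_sign n x j * edge_sign n (flip n j x) i).
Proof.
move=> ij; rewrite /edge_sign !parity_flip !signr_addb.
case: (ltngtP i j) => [lt|lt|/val_inj eq]; last by rewrite eq eqxx in ij.
  by rewrite /= expr0 expr1; ring.
by rewrite /= expr0 expr1; ring.
Qed.

Lemma signed_cube_sqr n (S : {set 'I_n}) (v : input n -> R) x :
  \sum_(i in S) edge_sign n x i *
    (\sum_(j in S) edge_sign n (flip n i x) j * v (flip n j (flip n i x)))
  = #|S|%:R * v x.
Proof.
pose F i j :=
  edge_sign n x i * edge_sign n (flip n i x) j * v (flip n j (flip n i x)).
have -> : \sum_(i in S) edge_sign n x i *
    (\sum_(j in S) edge_sign n (flip n i x) j * v (flip n j (flip n i x)))
    = \sum_(i in S) \sum_(j in S) F i j.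
  apply: eq_bigr => i _; rewrite mulr_sumr; apply: eq_bigr => j _.
  by rewrite /F mulrA.
(* Off the diagonal [F] is antisymmetric, and [F i i] is [v x]. Summing this single identity over
   all pairs gives the double sum as a constant minus itself. *)
have FC i j : F i j = (if i == j then v x *+ 2 else 0) - F j i.
  rewrite /F; case: eqVneq => [->|ij].
    by rewrite edge_sign_sqr flipK; ring.
  by rewrite (edge_sign_anticomm n x i j ij) flipC; ring.
set s := \sum_(i in S) _.
have : s = (#|S|%:R * v x) *+ 2 - s.
  rewrite {1}/s.
  under eq_bigr => i _ do under eq_bigr => j _ do rewrite FC.
  under eq_bigr => i iS do rewrite big_split /= sumrN -big_mkcondr /=.
  rewrite big_split /= sumrN; congr (_ - _); last by rewrite exchange_big.
  rewrite (eq_bigr (fun=> v x *+ 2)) => [|i iS].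
    by rewrite sumr_const mulrnAC mulr_natl.
  rewrite (big_pred1 i) // => j /=.
  by rewrite eq_sym; case: eqVneq => [->|]; rewrite ?iS ?andbF.
by move=> ?; lra.
Qed.

(* The equation B v = sqrt |S| v only has to be imposed at odd points, at most
   |H| - 1 linear conditions: at even points it follows from B^2 = |S|. *)
Lemma huang_vector n (S : {set 'I_n}) (H : {set input n}) :
  (0 < #|S|)%N ->
  (#|[set x | subcube n S x && parity n predT x]| < #|H|)%N ->
  exists v : input n -> R, [/\ exists x, v x != 0,
    forall x, x \notin H -> v x = 0 &
    forall x, subcube n S x ->
      \sum_(i in S) edge_sign n x i * v (flip n i x) = Num.sqrt #|S|%:R * v x].
Proof.
move=> S0 ltH; set d : R := Num.sqrt _.
have d0 : d != 0 by rewrite sqrtr_eq0 -ltNge ltr0n.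
have dd : d * d = #|S|%:R by rewrite -expr2 sqr_sqrtr // ler0n.
(* Column [y] of [M] holds the coefficients, in the unknowns [v x], of the eigenvector equation at
   the point [y]. *)
pose M x y :=
  \sum_(i in S) edge_sign n y i * (x == flip n i y)%:R - d * (x == y)%:R.
have [v [v0 vH vM]] := underdetermined _ _ H _ M ltH.
have pick (y : input n) : \sum_x (x == y)%:R * v x = v y.
  rewrite (bigD1 y) //= eqxx mul1r big1 ?addr0 // => x /negPf ->.
  by rewrite mul0r.
have odd_eq x : subcube n S x -> parity n predT x ->
    \sum_(i in S) edge_sign n x i * v (flip n i x) = d * v x.
  move=> xS xodd; apply/eqP; rewrite -subr_eq0; apply/eqP.
  rewrite -[RHS](vM x) ?inE ?xS //.
  under [RHS]eq_bigr => y _ do rewrite mulrBl mulr_suml -mulrA.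
  rewrite sumrB -mulr_sumr pick exchange_big /=; congr (_ - _).
  apply: eq_bigr => i _; under [RHS]eq_bigr => y _ do rewrite -mulrA.
  by rewrite -mulr_sumr pick.
exists v; split=> // x xS; case: (boolP (parity n predT x)) => [|xeven].
  exact: odd_eq.
apply: (mulfI d0); rewrite mulrA dd -signed_cube_sqr mulr_sumr.
apply: eq_bigr => i iS; rewrite odd_eq ?subcube_flip ?parity_flip ?(negPf xeven) //.
by rewrite mulrCA.
Qed.

(** * Spectral lower bound for the graph of sensitive edges *)

Lemma sensitivity_spectral_lower_bound n (f : input n -> bool) (p : mlpoly n) :
  agrees p f -> (0 < mldeg p)%N ->
  exists u : input n -> R, [/\ forall x, 0 <= u x, 0 < \sum_x u x ^+ 2 &
    Num.sqrt (mldeg p)%:R * \sum_x u x ^+ 2 <=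
    \sum_x \sum_i (f x != f (flip n i x))%:R * (u x * u (flip n i x))].
Proof.
move=> pf p0.
have [S [pS Sdeg]] : exists S, p S != 0 /\ #|S| = mldeg p.
  have [S pS] : exists S, p S != 0.
    apply/existsP; apply: contraLR p0 => /existsPn p0.
    by rewrite /mldeg big_pred0 // => S; have := p0 S; rewrite negbK => ->.
  pose nz := [pred S' | p S' != 0].
  have nz0 : (0 < #|nz|)%N by apply/card_gt0P; exists S.
  have [S' pS' E] := eq_bigmax_cond (fun S : {set 'I_n} => #|S|) nz0.
  by exists S'; split; [exact: pS' | rewrite /mldeg -E].
have Smax S' : p S' != 0 -> (#|S'| <= #|S|)%N.
  move=> pS'; rewrite Sdeg.
  exact: (leq_bigmax_cond (P := fun S : {set 'I_n} => p S != 0) S' pS').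
rewrite -Sdeg in p0 *.
have [i0 i0S] := card_gt0P p0.
have [b sumS] := leading_coef_sum n p S Smax.
have [|c Hc] := unbalanced_half n S i0 f i0S.
  under eq_bigr => x _ do rewrite -pf.
  by rewrite sumS mulf_neq0 // signr_eq0.
have [v [[x0 vx0] vH vE]] := huang_vector n S _ p0 Hc.
exists (fun x => `|v x|); split=> //.
  rewrite (bigD1 x0) //= ltr_pwDl ?exprn_gt0 ?normr_gt0 //.
  by apply: sumr_ge0 => x _; rewrite exprn_ge0.
rewrite mulr_sumr; apply: ler_sum => x _.
have [->|vx] := eqVneq (v x) 0.
  by rewrite normr0 expr0n mulr0 sumr_ge0 // => i _; rewrite mul0r mulr0.
have inH y : v y != 0 -> subcube n S y && (f y (+) parity n predT y == c).
  by move=> vy; apply: contraNT vy => yH; apply/eqP/vH; rewrite inE.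
have /andP[xS /eqP fx] := inH x vx.
rewrite expr2 mulrCA -{1}[Num.sqrt _]ger0_norm ?sqrtr_ge0 // -normrM -vE //.
apply: le_trans (_ : `|v x| * \sum_(i in S) `|v (flip n i x)| <= _).
  rewrite ler_wpM2l //; apply: le_trans (ler_norm_sum _ _ _) _.
  by apply: ler_sum => i _; rewrite normrM normrX normrN1 expr1n mul1r.
rewrite mulr_sumr big_mkcond; apply: ler_sum => i _; case: ifP => _; last first.
  by rewrite !mulr_ge0.
have [->|vy] := eqVneq (v (flip n i x)) 0.
  by rewrite normr0 !mulr0.
(* Both ends of the edge lie in the level set where [f] (+) parity equals [c]; the parity changes
   along the edge, hence so does [f]. *)
have /andP[_ /eqP] := inH _ vy; rewrite parity_flip -fx.
case: (f x); case: (f (flip n i x)); case: (parity n predT x) => //= _;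
by rewrite mul1r.
Qed.

(** * Real parts of inner products of quantum states *)

Definition rdot m (a b : 'cV[C]_m) : R :=
  \sum_j (complex.Re (a j 0) * complex.Re (b j 0) +
          complex.Im (a j 0) * complex.Im (b j 0)).

Lemma rdotE m (a b : 'cV[C]_m) :
  rdot m a b = complex.Re ((map_mx (fun z : C => z^*) a^T *m b) 0 0).
Proof.
rewrite mxE raddf_sum; apply: eq_bigr => j _; rewrite !mxE.
by case: (a j 0) (b j 0) => [? ?] [? ?] /=; ring.
Qed.

Lemma rdot_unitary m (U : 'M[C]_m) (a b : 'cV[C]_m) :
  unitary U -> rdot m (U *m a) (U *m b) = rdot m a b.
Proof.
move=> /mulmx1C UU; rewrite !rdotE trmx_mul map_mxM /= -mulmxA.
by rewrite (mulmxA _ U) [X in X *m b]UU mul1mx.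
Qed.

Lemma oracle_entry n m (qreg : 'I_m -> option 'I_n) x (a : 'cV[C]_m) j :
  (oracle qreg x *m a) j 0 =
  (if qreg j is Some i then (-1) ^+ x i else 1) * a j 0.
Proof. by rewrite /oracle mul_diag_mx !mxE. Qed.

(** The two oracles differ only in the phase of basis states that query [i]: there the product of
    the phases is -1, elsewhere it is 1. *)
Lemma rdot_oracle n m (qreg : 'I_m -> option 'I_n) x i (a b : 'cV[C]_m) :
  rdot m a b - rdot m (oracle qreg x *m a) (oracle qreg (flip n i x) *m b) =
  \sum_(j | qreg j == Some i)
     (complex.Re (a j 0) * complex.Re (b j 0) +
      complex.Im (a j 0) * complex.Im (b j 0)) *+ 2.
Proof.
rewrite -sumrB [RHS]big_mkcond; apply: eq_bigr => j _; rewrite !oracle_entry.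
case: (qreg j) => [k|] /=; last by rewrite !mul1r subrr.
rewrite ffunE (inj_eq Some_inj).
case: (a j 0) (b j 0) => [a1 a2] [b1 b2].
by case: (k == i); case: (x k); rewrite /= ?expr0 ?expr1 ?mul1r ?mulN1r /=; ring.
Qed.

Lemma rdot_oracle_same n m (qreg : 'I_m -> option 'I_n) x (a : 'cV[C]_m) :
  rdot m (oracle qreg x *m a) (oracle qreg x *m a) = rdot m a a.
Proof.
apply: eq_bigr => j _; rewrite !oracle_entry; case: (a j 0) => [a1 a2].
case: (qreg j) => [k|]; last by rewrite mul1r.
by case: (x k); rewrite ?expr0 ?expr1 ?mul1r ?mulN1r /=; ring.
Qed.

Lemma rdot_init m : rdot m.+1 (init m) (init m) = 1.
Proof.
rewrite /rdot (bigD1 0) //= big1 => [|j j0]; rewrite !mxE ?eqxx /=; first by ring.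
by rewrite (negPf j0) /=; ring.
Qed.

Lemma run_norm n (A : qalg n) T x :
  (forall t, (t <= T)%N -> unitary (qa_U A t)) ->
  rdot _ (run (qa_U A) (oracle (qa_qreg A) x) T)
         (run (qa_U A) (oracle (qa_qreg A) x) T) = 1.
Proof.
elim: T => [|T IH] AU /=; rewrite (rdot_unitary _ _ _ _ (AU _ (leqnn _))).
  exact: rdot_init.
by rewrite rdot_oracle_same IH // => t tT; apply: AU; apply: leqW.
Qed.

(* Weighted AM-GM: weights 2/3 and 3/2 on accepting entries, swapped on
   rejecting ones, give (13/6 + (5/6) (q - p)) / 2 <= 17/18, where p >= 2/3 and
   q <= 1/3 are the acceptance probabilities of a and b. *)
Lemma rdot_distinguishable m (acc : {set 'I_m}) (a b : 'cV[C]_m) :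
  rdot m a a = 1 -> rdot m b b = 1 ->
  2 / 3 <= \sum_(j in acc) sqmod (a j 0) ->
  2 / 3 <= 1 - \sum_(j in acc) sqmod (b j 0) ->
  rdot m a b <= 17 / 18.
Proof.
have split_norm (c : 'cV[C]_m) : rdot m c c =
    \sum_(j in acc) sqmod (c j 0) + \sum_(j | j \notin acc) sqmod (c j 0).
  rewrite /rdot (bigID (mem acc)); congr (_ + _); apply: eq_bigr => j _;
  by rewrite /sqmod !expr2.
rewrite !split_norm => na nb pa pb.
have am (w : R) (a1 a2 b1 b2 : R) : w = 2 / 3 \/ w = 3 / 2 ->
    a1 * b1 + a2 * b2 <= w / 2 * (a1 ^+ 2 + a2 ^+ 2) + w^-1 / 2 * (b1 ^+ 2 + b2 ^+ 2).
  have s1 := sqr_ge0 (2 * a1 - 3 * b1); have s2 := sqr_ge0 (2 * a2 - 3 * b2).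
  have s3 := sqr_ge0 (3 * a1 - 2 * b1); have s4 := sqr_ge0 (3 * a2 - 2 * b2).
  have -> : (3 / 2 : R) = (2 / 3)^-1 by rewrite invf_div.
  by case=> ->; rewrite ?invrK ?invf_div; lra.
have : rdot m a b <=
    (1 / 3 * \sum_(j in acc) sqmod (a j 0) + 3 / 4 * \sum_(j in acc) sqmod (b j 0)) +
    (3 / 4 * \sum_(j | j \notin acc) sqmod (a j 0) +
     1 / 3 * \sum_(j | j \notin acc) sqmod (b j 0)).
  rewrite /rdot (bigID (mem acc)) !mulr_sumr -!big_split /=.
  apply: lerD; apply: ler_sum => j _; rewrite /sqmod.
    by apply: le_trans (am (2 / 3) _ _ _ _ (or_introl erefl)) _; rewrite invf_div; lra.
  by apply: le_trans (am (3 / 2) _ _ _ _ (or_intror erefl)) _; rewrite invf_div; lra.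
lra.
Qed.

Lemma rdotC m (a b : 'cV[C]_m) : rdot m a b = rdot m b a.
Proof. by apply: eq_bigr => j _; rewrite mulrC [X in _ + X]mulrC. Qed.

(** * The adversary upper bound *)

Section Adversary.

Variables (n : nat) (f : input n -> bool) (u : input n -> R) (A : qalg n).

Definition sens_weight x i : R :=
  (f x != f (flip n i x))%:R * (u x * u (flip n i x)).

Definition state t x := run (qa_U A) (oracle (qa_qreg A) x) t.

(** The adversary potential: it starts at the total weight of the sensitive edges, and a correct
    algorithm must bring it below a fixed fraction of that weight. *)
Definition progress t : R :=
  \sum_x \sum_i sens_weight x i * rdot _ (state t x) (state t (flip n i x)).

Lemma progress0 : unitary (qa_U A 0) ->
  progress 0 = \sum_x \sum_i sens_weight x i.
Proof.
move=> U0; apply: eq_bigr => x _; apply: eq_bigr => i _.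
by rewrite rdot_unitary // rdot_init mulr1.
Qed.

Lemma progress_step t :
  unitary (qa_U A t.+1) -> (forall x, rdot _ (state t x) (state t x) = 1) ->
  progress t - progress t.+1 <= 2 * \sum_x u x ^+ 2.
Proof.
move=> Ut norm1.
(* The probability that the next query on input [x] asks for bit [i]. The sum over [i] may fall
   below 1, since some basis states make no query. *)
pose q x i := \sum_(j | qa_qreg A j == Some i) sqmod (state t x j 0).
have qle x : \sum_i q x i <= 1.
  rewrite -(norm1 x) /q (exchange_big_dep xpredT) //= /rdot.
  apply: ler_sum => j _.
  have sq0 : 0 <= sqmod (state t x j 0) by rewrite addr_ge0 ?sqr_ge0.
  rewrite -!expr2 -/(sqmod _); case: (qa_qreg A j) => [k|]; last by rewrite big_pred0.
  by rewrite (big_pred1 k) // => i; rewrite /= (inj_eq Some_inj) eq_sym.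
(* AM-GM on each basis state that queries [i] separates the contributions of the two ends of the
   edge. *)
have edge x i : sens_weight x i * rdot _ (state t x) (state t (flip n i x)) -
    sens_weight x i * rdot _ (state t.+1 x) (state t.+1 (flip n i x)) <=
    u x ^+ 2 * q x i + u (flip n i x) ^+ 2 * q (flip n i x) i.
  rewrite -mulrBr /= rdot_unitary // rdot_oracle !mulr_sumr -big_split.
  apply: ler_sum => j _ /=; rewrite /sens_weight /sqmod.
  set a1 := complex.Re _; set b1 := complex.Re _.
  set a2 := complex.Im _; set b2 := complex.Im _.
  move: (u x) (u (flip n i x)) => c e; case: (_ != _) => /=.
    have := sqr_ge0 (c * a1 - e * b1); have := sqr_ge0 (c * a2 - e * b2).
    by rewrite !expr2; lra.
  by rewrite !mul0r addr_ge0 // mulr_ge0 ?addr_ge0 ?sqr_ge0.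
rewrite /progress -sumrB.
apply: le_trans (_ : \sum_x \sum_i (u x ^+ 2 * q x i +
    u (flip n i x) ^+ 2 * q (flip n i x) i) <= _).
  by apply: ler_sum => x _; rewrite -sumrB; apply: ler_sum => i _; exact: edge.
under eq_bigr => x _ do rewrite big_split.
rewrite big_split /= [X in _ + X]exchange_big /=.
(* Since [flip i] is a bijection for each fixed [i], the far ends of the edges contribute exactly as
   much as the near ends; this gives the factor 2. *)
under [X in _ + X]eq_bigr => i _ do rewrite (flip_sum n i (fun x => u x ^+ 2 * q x i)).
rewrite [X in _ + X]exchange_big /= -mulr2n mulr_natl lerMn2r /=.
apply: ler_sum => x _; rewrite -mulr_sumr ler_piMr ?sqr_ge0 //.
Qed.

(** At least 1/18 of the total weight must be lost, and each query loses at most twice the squared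
    norm of [u]; hence 36 = 18 * 2. *)
Lemma adversary_bound T : (forall x, 0 <= u x) -> computes f T A ->
  \sum_x \sum_i sens_weight x i <= 36 * T%:R * \sum_x u x ^+ 2.
Proof.
move=> u0 [AU Af].
have norm1 t x : (t <= T)%N -> rdot _ (state t x) (state t x) = 1.
  by move=> tT; apply: run_norm => s st; apply: AU; apply: leq_trans st tT.
have w0 x i : 0 <= sens_weight x i by rewrite !mulr_ge0.
have steps t : (t <= T)%N ->
    progress 0 - progress t <= t%:R * (2 * \sum_x u x ^+ 2).
  elim: t => [|t IH] tT; first by rewrite subrr mul0r.
  have := IH (ltnW tT); have := progress_step t (AU _ tT) (fun x => norm1 t x (ltnW tT)).
  by rewrite -natr1; lra.
have final : progress T <= 17 / 18 * \sum_x \sum_i sens_weight x i.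
  rewrite mulr_sumr; apply: ler_sum => x _; rewrite mulr_sumr.
  apply: ler_sum => i _; rewrite mulrC.
  have [fx|fx] := eqVneq (f x) (f (flip n i x)).
    by rewrite /sens_weight fx eqxx !(mul0r, mulr0).
  rewrite ler_wpM2r //.
  have := Af x; have := Af (flip n i x).
  move: fx; case: (f x); case: (f (flip n i x)) => //= _ Ay Ax.
    by apply: rdot_distinguishable Ax Ay; exact: norm1.
  (* Here [flip n i x] is the accepted input, so the two states exchange roles. *)
  by rewrite rdotC; apply: rdot_distinguishable Ay Ax; exact: norm1.
have := steps T (leqnn T); rewrite progress0; last exact: AU.
lra.
Qed.

End Adversary.

Theorem theorem1p3 :
  exists Cst : R, forall (n : nat) (f : input n -> bool) (p : mlpoly n) (T : nat),
    agrees p f -> isQ f T -> ((mldeg p)%:R : R) <= Cst * (T%:R) ^+ 2.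
Proof.
(* Comparing the two bounds on the same [u] gives [sqrt (deg f) <= 36 T], which is then squared.
   Degree 0 is treated apart, because the spectral bound needs a nonempty top monomial. *)
exists (36 ^+ 2) => n f p T pf [[A Af] _].
have [->|] := posnP (mldeg p); first by rewrite mulr_ge0 ?exprn_ge0 ?ler0n.
move=> /(sensitivity_spectral_lower_bound n f p pf)[u [u0 unorm low]].
have := le_trans low (adversary_bound n f u A T u0 Af).
rewrite ler_pM2r // => sqrt_le.
rewrite -(sqr_sqrtr (ler0n R (mldeg p))) -exprMn lerXn2r // nnegrE.
  exact: sqrtr_ge0.
exact: mulr_ge0.
Qed.
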